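(* Let $H=(h_{ij})$ be an $n\times n$ real upper Hessenberg matrix with diagonal elements $\alpha_i=h_{ii}$ and subdiagonal elements $\beta_i=h_{i,i-1}$, and assume the floating point assumptions stated in the context. If $$\hat{c}_2^{(2)}=\mathrm{fl}\Big[\mathrm{fl}\left[\alpha_1\alpha_2\right]-\mathrm{fl}\left[h_{12}\,\beta_2\right]\Big],$$ $$\hat c_2^{(i)}=\mathrm{fl}\Big[\mathrm{fl}\left[\hat c_2^{(i-1)}-\mathrm{fl}\left[\alpha_i\hat{c}_1^{(i-1)}\right]\right]-\mathrm{fl}\left[h_{i-1,i}\,\beta_i\right]\Big], \qquad 3\leq i\leq n,$$ then $$|e_2^{(2)}| \leq u\left(|\alpha_2\alpha_1|+|h_{12}\beta_2|+|\hat c_2^{(2)}|\right)$$ and, for $3\le i\le n$, $$|e_2^{(i)}|\leq |e_2^{(i-1)}|+|\alpha_ie_1^{(i-1)}|+u\left(|\hat c_2^{(i-1)}|+|h_{i-1,i}\,\beta_i|+|\hat c_2^{(i)}|\right)+\gamma_2\,|\alpha_i\hat{c}_1^{(i-1)}|.$$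
   Context: $H_i$ is the leading principal submatrix of $H$ of order $i$, and $\det(\lambda I-H_i)=\lambda^i+c_1^{(i)}\lambda^{i-1}+\cdots+c_{i-1}^{(i)}\lambda+c_i^{(i)}$, $1\le i\le n$. Thus $c_1^{(1)}=-\alpha_1$, $c_1^{(i)}=c_1^{(i-1)}-\alpha_i$ for $i\ge2$, $c_2^{(2)}=\alpha_1\alpha_2-h_{12}\beta_2$, and $c_2^{(i)}=c_2^{(i-1)}-\alpha_ic_1^{(i-1)}-h_{i-1,i}\beta_i$ for $i\ge 3$. Floating point assumptions: all matrix elements are normalized real floating point numbers; $u$ is the unit roundoff and $nu<1$; no operation underflows or overflows; $\mathrm{fl}[\cdot]$ denotes the result computed in floating point arithmetic. For $\mathrm{op}\in\{+,-,\times,/\}$ and normalized real floating point numbers $x,y$ such that $x\ \mathrm{op}\ y$ does not underflow or overflow, $\mathrm{fl}[x\ \mathrm{op}\ y]=(x\ \mathrm{op}\ y)(1+\delta)$ for some $|\delta|\le u$, and also $\mathrm{fl}[x\ \mathrm{op}\ y]=(x\ \mathrm{op}\ y)/(1+\epsilon)$ for some $|\epsilon|\le u$. $\gamma_m=\frac{mu}{1-mu}$. $\hat c_j^{(i)}$ denotes the floating point computed value of $c_j^{(i)}$, with error $e_j^{(i)}=\hat c_j^{(i)}-c_j^{(i)}$. The values $\hat c_1^{(i)}$ are computed by $\hat c_1^{(1)}=c_1^{(1)}=-\alpha_1$ (exact, so $e_1^{(1)}=0$) and $\hat{c}_1^{(i)}=\mathrm{fl}[\hat{c}_1^{(i-1)}-\alpha_i]$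 for $2\le i\le n$. *)

(* Defs.v *)
From HB Require Import structures.
From mathcomp Require Import all_boot all_order all_algebra.
From mathcomp Require Import reals.

Set Implicit Arguments.
Unset Strict Implicit.
Unset Printing Implicit Defensive.

Import Order.TTheory GRing.Theory Num.Theory.

Local Open Scope ring_scope.

Inductive fpop : Type := OpAdd | OpSub | OpMul | OpDiv.

Definition exact_op (R : realType) (o : fpop) (x y : R) : R :=
  match o with
  | OpAdd => x + y
  | OpSub => x - y
  | OpMul => x * y
  | OpDiv => x / y
  end.

(* The standard model of floating point arithmetic.  [fl F o x y] is
   fl[x o y]; it is indexed by the operation and its operands, so it need not
   be a function of the exact real result.  [no_exc F o x y] says that
   computing x o y neither underflows nor overflows.  [fpnum F] is the set of
   normalized floating point numbers; since it must contain the results of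
   exception-free operations, an instance would normally put 0 in it.
   Division by zero is excluded separately because x / 0 = 0 in MathComp. *)
Record fparith (R : realType) : Type := FpArith {
  fpnum : R -> Prop;
  no_exc : fpop -> R -> R -> Prop;
  fl : fpop -> R -> R -> R;
  uround : R;
  uround_gt0 : 0 < uround;
  fpnumN : forall x : R, fpnum x -> fpnum (- x);
  fl_num : forall (o : fpop) (x y : R), fpnum x -> fpnum y ->
    (o = OpDiv -> y != 0) -> no_exc o x y -> fpnum (fl o x y);
  fl_mul_model : forall (o : fpop) (x y : R), fpnum x -> fpnum y ->
    (o = OpDiv -> y != 0) -> no_exc o x y ->
    exists2 delta : R, `|delta| <= uround
      & fl o x y = exact_op o x y * (1 + delta);
  fl_div_model : forall (o : fpop) (x y : R), fpnum x -> fpnum y ->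
    (o = OpDiv -> y != 0) -> no_exc o x y ->
    exists2 epsilon : R, `|epsilon| <= uround
      & fl o x y = exact_op o x y / (1 + epsilon)
}.

Definition gamma (R : realType) (F : fparith R) (m : nat) : R :=
  m%:R * uround F / (1 - m%:R * uround F).

Definition upper_hessenberg (R : realType) (n : nat) (H : 'M[R]_n) : Prop :=
  forall i j : 'I_n, (j.+1 < i)%N -> H i j = 0.

(* h_{ij} with one-based indices, meaningful for 1 <= i, j <= n
   (see [entryE]). *)
Definition entry (R : realType) (n : nat) (H : 'M[R]_n) (i j : nat) : R :=
  match insub i.-1, insub j.-1 with
  | Some a, Some b => H a b
  | _, _ => 0
  end.

Lemma entryE (R : realType) (n : nat) (H : 'M[R]_n) (a b : 'I_n) :
  entry H a.+1 b.+1 = H a b.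
Proof. by rewrite /entry /= !valK. Qed.

Definition alpha (R : realType) (n : nat) (H : 'M[R]_n) (i : nat) : R :=
  entry H i i.

Definition beta (R : realType) (n : nat) (H : 'M[R]_n) (i : nat) : R :=
  entry H i i.-1.

Definition lead_mx (R : realType) (n : nat) (H : 'M[R]_n) (i : nat) : 'M[R]_i :=
  \matrix_(a < i, b < i) entry H a.+1 b.+1.

Lemma lead_mxE (R : realType) (n : nat) (H : 'M[R]_n) (i : nat)
    (le_in : (i <= n)%N) :
  lead_mx H i = mxsub (widen_ord le_in) (widen_ord le_in) H.
Proof. by apply/matrixP=> a b; rewrite !mxE -entryE. Qed.

(* c_j^{(i)}, the coefficient of lambda^{i-j} in det(lambda I - H_i);
   meaningful for j <= i <= n. *)
Definition ccoef (R : realType) (n : nat) (H : 'M[R]_n) (j i : nat) : R :=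
  (char_poly (lead_mx H i))`_(i - j).

(* e_j^{(i)}, where [chat j i] is the computed value of c_j^{(i)}. *)
Definition cerr (R : realType) (n : nat) (H : 'M[R]_n)
    (chat : nat -> nat -> R) (j i : nat) : R :=
  chat j i - ccoef H j i.

(* Main.v *)
Require Import Defs.
From HB Require Import structures.
From mathcomp Require Import all_boot all_order all_algebra.
From mathcomp Require Import reals.
From mathcomp Require Import ring lra zify.

(** The coefficient of [X^(m-1)] in [\adj (X I - A)] is the identity matrix, so
    the Schur-type expansion
    [det (X I - H_i) = (X - alpha_i) det (X I - H_(i-1)) - r adj(X I - H_(i-1)) c],
    where [r] and [c] are the last row and column of [H_i], gives
    [c_2^(i) = c_2^(i-1) - alpha_i c_1^(i-1) - r c], and [r c] reduces to
    [h_(i-1,i) beta_i] by the Hessenberg shape.  Subtracting this exact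
    recurrence from the computed one gives the bound: the outermost rounding
    uses [fl = op / (1 + eps)], so its error is proportional to the computed
    value, the inner ones use [fl = op (1 + delta)], and
    [(1 + delta)(1 + delta') - 1] is at most [gamma_2] in absolute value. *)

Set Implicit Arguments.
Unset Strict Implicit.
Unset Printing Implicit Defensive.

Import Order.TTheory GRing.Theory Num.Theory.

Local Open Scope ring_scope.

(** * Characteristic polynomial of a bordered matrix *)

(** Left multiplication by [L], itself of determinant [\det A], clears the lower left block.
    Cancelling the common factor [\det A] avoids inverting [A], so this applies to polynomial
    matrices. *)
Lemma det_block_adj (R : idomainType) (m : nat) (A : 'M[R]_m)
    (c : 'cV[R]_m) (r : 'rV[R]_m) (d : 'M[R]_1) : \det A != 0 ->
  \det (block_mx A c r d) = d 0 0 * \det A - (r *m \adj A *m c) 0 0.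
Proof.
move=> detA_neq0; apply: (mulfI detA_neq0).
pose L := block_mx 1%:M 0 (- (r *m \adj A)) (\det A)%:M.
have detL : \det L = \det A by rewrite det_lblock det1 mul1r det_scalar1.
rewrite -{1}detL -det_mulmx mulmx_block !mul1mx !mul0mx !addr0.
rewrite mulNmx -(mulmxA r _ A) mul_adj_mx mul_mx_scalar mul_scalar_mx addNr.
by rewrite det_ublock det_mx11 mulNmx mul_scalar_mx !mxE; ring.
Qed.

Lemma size_det_leq (R : idomainType) (m : nat) (M : 'M[{poly R}]_m) :
  (forall i j, (size (M i j) <= 2)%N) -> (size (\det M) <= m.+1)%N.
Proof.
move=> szM; apply: (leq_trans (size_sum _ _ _)); apply/bigmax_leqP => s _.
rewrite mulr_sign.
have -> (p : {poly R}) (b : bool) : size (if b then - p else p) = size p.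
  by case: b; rewrite ?size_polyN.
apply: (leq_trans (size_prod_leq _ _)); rewrite card_ord leq_subLR.
apply: (@leq_trans (\sum_(i < m) 2).+1); first by rewrite ltnS leq_sum.
by rewrite sum_nat_const card_ord; lia.
Qed.

Lemma size_char_poly_mx (R : idomainType) (m : nat) (A : 'M[R]_m) i j :
  (size (char_poly_mx A i j) <= 2)%N.
Proof.
rewrite !mxE; apply: leq_trans (size_polyD _ _) _.
rewrite geq_max size_polyN (leq_trans (size_polyC_leq1 _)) // andbT.
by case: eqP => _; rewrite ?mulr1n ?mulr0n ?size_polyX ?size_poly0.
Qed.

(** Compare coefficients of X^(m+1) in adj(XI - A) (XI - A) = det(XI - A) I, whose right-hand side
    is monic of degree m+1 on the diagonal. *)
Lemma coef_adj_char_poly_mx (R : idomainType) (m : nat) (A : 'M[R]_m.+1) i j :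
  (\adj (char_poly_mx A) i j)`_m = (i == j)%:R.
Proof.
(* Up to sign these are minors of order m with entries of degree at most 1. *)
have sz k l : (size (\adj (char_poly_mx A) k l) <= m.+1)%N.
  rewrite mxE /cofactor -signr_odd mulr_sign.
  have -> (p : {poly R}) (b : bool) : size (if b then - p else p) = size p.
    by case: b; rewrite ?size_polyN.
  by apply: size_det_leq => a b; rewrite 2!mxE size_char_poly_mx.
have := mul_adj_mx (char_poly_mx A); move: (\adj _) sz => B sz.
rewrite {1}/char_poly_mx mulmxBr mul_mx_scalar.
move=> /matrixP/(_ i j)/(congr1 (fun p : {poly R} => p`_m.+1)).
(* By [sz], [B] times the constant matrix has degree at most m, so only X [B] contributes. *)
rewrite !mxE coefB coefXM coef_sum big1 ?subr0 /= => [->|k _]; last first.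
  by rewrite mxE coefMC nth_default ?mul0r.
have := char_poly_monic A; rewrite monicE lead_coefE size_char_poly => /eqP <-.
by rewrite coefMn; case: eqP.
Qed.

Lemma char_poly_mx_block (R : nzRingType) (m : nat) (A : 'M[R]_m)
    (c : 'cV[R]_m) (r : 'rV[R]_m) (d : 'M[R]_1) :
  char_poly_mx (block_mx A c r d) =
  block_mx (char_poly_mx A) (- map_mx polyC c) (- map_mx polyC r) (char_poly_mx d).
Proof.
by rewrite /char_poly_mx map_block_mx scalar_mx_block opp_block_mx add_block_mx !add0r.
Qed.

(** The bordered matrix has order m+3, so index m+1 picks out its c_2; indices m and m+1 for [A]
    pick out c_2 and c_1. *)
Lemma coef_char_poly_block (R : idomainType) (m : nat) (A : 'M[R]_m.+2)
    (c : 'cV[R]_m.+2) (r : 'rV[R]_m.+2) (d : 'M[R]_1) :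
  (char_poly (block_mx A c r d))`_m.+1 =
  (char_poly A)`_m - d 0 0 * (char_poly A)`_m.+1 - (r *m c) 0 0.
Proof.
rewrite {1}/char_poly char_poly_mx_block det_block_adj; last first.
  exact/monic_neq0/char_poly_monic.
move: (\adj _) (coef_adj_char_poly_mx A) => B BE.
rewrite -/(char_poly A) coefB !mxE eqxx mulr1n mulrBl !coefB coefXM coefCM /=.
congr (_ - _); rewrite coef_sum; apply: eq_bigr => j _.
rewrite !mxE mulrN coefN coefMC coef_sum.
(* At degree m+1 the adjugate is the identity: only k = j survives, and the signs of -r and -c
   cancel. *)
rewrite (bigD1 j) //= big1 ?addr0 => [|k kj]; rewrite !mxE mulNr coefN coefCM.
  by rewrite BE eqxx mulr1 mulNr opprK.
by rewrite BE (negPf kj) mulr0 oppr0.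
Qed.

(** * Exact recurrence for c_2 *)

Lemma lead_mxS (R : realType) (n : nat) (H : 'M[R]_n) (m : nat) :
  lead_mx H (m + 1) =
  block_mx (lead_mx H m) (\col_(a < m) entry H a.+1 m.+1)
           (\row_(b < m) entry H m.+1 b.+1) (alpha H m.+1)%:M.
Proof.
rewrite -[LHS]submxK; congr block_mx; apply/matrixP => a b; rewrite !mxE //=.
- by rewrite (ord1 b) addn0.
- by rewrite (ord1 a) addn0.
- by rewrite (ord1 a) (ord1 b) addn0 mulr1n.
Qed.

Lemma ccoef2_rec (R : realType) (n : nat) (H : 'M[R]_n) (i : nat) :
  upper_hessenberg H -> (3 <= i <= n)%N ->
  ccoef H 2 i =
  ccoef H 2 i.-1 - alpha H i * ccoef H 1 i.-1 - entry H i.-1 i * beta H i.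
Proof.
move=> hess; case: i => [|[|[|m]]] // /andP[_ mn].
rewrite /ccoef !subSS !subn0 /=.
(* The two orders are equal but not convertible; the type of [char_poly] does not depend on the
   order, so the equation is well typed. *)
have -> : char_poly (lead_mx H m.+3) = char_poly (lead_mx H (m.+2 + 1)).
  by rewrite addn1.
rewrite lead_mxS coef_char_poly_block.
rewrite mxE eqxx mulr1n; congr (_ - _).
(* Every term but the last has its row factor at least two places below the diagonal. *)
rewrite mxE big_ord_recr big1 => [|k _]; rewrite !mxE /=.
  by rewrite add0r mulrC.
have km := ltn_ord k.
have kn : (k < n)%N by lia.
by rewrite (entryE H (Ordinal mn) (Ordinal kn)) hess ?mul0r.
Qed.

Lemma ccoef22 (R : realType) (n : nat) (H : 'M[R]_n) :
  ccoef H 2 2 = alpha H 1 * alpha H 2 - entry H 1 2 * beta H 2.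
Proof.
(* Here c_2 is the constant coefficient, i.e. (-1)^2 times the determinant. *)
rewrite /ccoef subnn char_poly_det sqrrN expr1n mul1r (expand_det_row _ 0).
rewrite !big_ord_recl big_ord0 /cofactor !det_mx11 !mxE /=.
by rewrite expr0 expr1 mul1r mulN1r mulrN addr0.
Qed.

(** * Rounding errors *)

Lemma fpnum_entry (R : realType) (F : fparith R) (n : nat) (H : 'M[R]_n) (i j : nat) :
  (forall a b : 'I_n, fpnum F (H a b)) ->
  (0 < i <= n)%N -> (0 < j <= n)%N -> fpnum F (entry H i j).
Proof.
case: i j => [|i] [|j] // Hnum /= ltin ltjn.
by rewrite (entryE H (Ordinal ltin) (Ordinal ltjn)).
Qed.

Lemma sub_round_error (R : realFieldType) (u x y z eps : R) :
  u < 1 -> `|eps| <= u -> z = (x - y) / (1 + eps) ->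
  z = x - y - eps * z.
Proof.
rewrite ler_norml => u1 /andP[? _] ->.
have ? : 1 + eps != 0 by apply: lt0r_neq0; lra.
by field.
Qed.

Lemma ler_norm_mul_bound (R : realFieldType) (u d x : R) :
  `|d| <= u -> `|d * x| <= u * `|x|.
Proof. by move=> du; rewrite normrM ler_wpM2r. Qed.

Lemma ler_norm_mul_bound3 (R : realFieldType) (u d1 d2 d3 x y z : R) :
  `|d1| <= u -> `|d2| <= u -> `|d3| <= u ->
  `|d1 * x - d2 * y - d3 * z| <= u * (`|x| + `|y| + `|z|).
Proof.
move=> h1 h2 h3; rewrite !mulrDr.
apply: le_trans (ler_normB _ _) (lerD _ (ler_norm_mul_bound _ h3)).
exact: le_trans (ler_normB _ _) (lerD (ler_norm_mul_bound _ h1) (ler_norm_mul_bound _ h2)).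
Qed.

Lemma two_rounding_gamma (R : realType) (F : fparith R) (d1 d2 : R) :
  2%:R * uround F < 1 -> `|d1| <= uround F -> `|d2| <= uround F ->
  `|(1 + d1) * (1 + d2) - 1| <= gamma F 2.
Proof.
move=> u1 h1 h2; have u0 := uround_gt0 F; rewrite /gamma.
set u := uround F in u0 u1 h1 h2 *.
have -> : (1 + d1) * (1 + d2) - 1 = d1 + d2 + d1 * d2 by ring.
have h3 : `|d1 * d2| <= u * u by rewrite normrM ler_pM.
apply: (@le_trans _ _ (2 * u + u * u)).
  have := ler_normD (d1 + d2) (d1 * d2); have := ler_normD d1 d2; lra.
(* (2u + u^2)(1 - 2u) = 2u - 3u^2 - 2u^3, which is at most 2u. *)
rewrite ler_pdivlMr; first by nra.
by lra.
Qed.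

Theorem theorem5p2 (R : realType) (F : fparith R) (n : nat) (H : 'M[R]_n)
  (chat : nat -> nat -> R)
  (n_ge2 : (2 <= n)%N)
  (H_hess : upper_hessenberg H)
  (H_num : forall i j : 'I_n, fpnum F (H i j))
  (nu_lt1 : n%:R * uround F < 1)
  (chat11 : chat 1%N 1%N = - alpha H 1)
  (chat1_rec : forall i : nat, (2 <= i <= n)%N ->
     chat 1%N i = fl F OpSub (chat 1%N i.-1) (alpha H i))
  (chat22 : chat 2%N 2%N =
     fl F OpSub (fl F OpMul (alpha H 1) (alpha H 2))
                (fl F OpMul (entry H 1 2) (beta H 2)))
  (chat2_rec : forall i : nat, (3 <= i <= n)%N ->
     chat 2%N i =
     fl F OpSub
       (fl F OpSub (chat 2%N i.-1) (fl F OpMul (alpha H i) (chat 1%N i.-1)))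
       (fl F OpMul (entry H i.-1 i) (beta H i)))
  (* none of the operations above underflows or overflows *)
  (exc_chat1 : forall i : nat, (2 <= i <= n)%N ->
     no_exc F OpSub (chat 1%N i.-1) (alpha H i))
  (exc_chat22 :
     [/\ no_exc F OpMul (alpha H 1) (alpha H 2),
         no_exc F OpMul (entry H 1 2) (beta H 2)
       & no_exc F OpSub (fl F OpMul (alpha H 1) (alpha H 2))
                        (fl F OpMul (entry H 1 2) (beta H 2))])
  (exc_chat2 : forall i : nat, (3 <= i <= n)%N ->
     [/\ no_exc F OpMul (alpha H i) (chat 1%N i.-1),
         no_exc F OpSub (chat 2%N i.-1) (fl F OpMul (alpha H i) (chat 1%N i.-1)),
         no_exc F OpMul (entry H i.-1 i) (beta H i)
       & no_exc F OpSub
           (fl F OpSub (chat 2%N i.-1) (fl F OpMul (alpha H i) (chat 1%N i.-1)))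
           (fl F OpMul (entry H i.-1 i) (beta H i))]) :
  `|cerr H chat 2 2| <=
    uround F * (`|alpha H 2 * alpha H 1| + `|entry H 1 2 * beta H 2|
                + `|chat 2%N 2%N|)
  /\
  (forall i : nat, (3 <= i <= n)%N ->
    `|cerr H chat 2 i| <=
      `|cerr H chat 2 i.-1| + `|alpha H i * cerr H chat 1 i.-1|
      + uround F * (`|chat 2%N i.-1| + `|entry H i.-1 i * beta H i|
                    + `|chat 2%N i|)
      + gamma F 2 * `|alpha H i * chat 1%N i.-1|).
Proof.
have u0 := uround_gt0 F.
have u2 : 2%:R * uround F < 1.
  by apply: le_lt_trans nu_lt1; rewrite ler_pM2r // ler_nat.
have u1 : uround F < 1 by lra.
(* The rounding models require floating point operands, so every intermediate value is first shown
   to be one. *)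
have num_c1 i : (1 <= i <= n)%N -> fpnum F (chat 1%N i).
  elim: i => [//|[|i] IH] lein.
    by rewrite chat11; apply/fpnumN/fpnum_entry.
  rewrite chat1_rec //; apply: fl_num => //; last exact: (exc_chat1 i.+2).
    by apply: IH; lia.
  exact: fpnum_entry.
have num_hb i : (2 <= i <= n)%N -> no_exc F OpMul (entry H i.-1 i) (beta H i) ->
    fpnum F (fl F OpMul (entry H i.-1 i) (beta H i)).
  by move=> lein; apply: fl_num => //; apply: fpnum_entry => //; lia.
have num_c22 : fpnum F (chat 2%N 2%N).
  have [e1 e2 e3] := exc_chat22.
  rewrite chat22; apply: fl_num => //; last exact: (num_hb 2).
  by apply: fl_num => //; apply: fpnum_entry => //; lia.
have num_ac i : (3 <= i <= n)%N -> fpnum F (fl F OpMul (alpha H i) (chat 1%N i.-1)).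
  move=> lein; have [e1 _ _ _] := exc_chat2 i lein.
  apply: fl_num => //; first by apply: fpnum_entry => //; lia.
  by apply: num_c1; lia.
have num_c2 i : (2 <= i <= n)%N -> fpnum F (chat 2%N i).
  elim: i => [//|[//|[|i]] IH] lein //.
  have [e1 e2 e3 e4] := exc_chat2 i.+3 lein.
  rewrite chat2_rec //; apply: fl_num => //; last exact: num_hb.
  by apply: fl_num => //; [apply: IH; lia | apply: num_ac].
split=> [|i lein].
  have [e1 e2 e3] := exc_chat22.
  have [n1 n2] : (0 < 1 <= n)%N /\ (0 < 2 <= n)%N by lia.
  have num_mul : fpnum F (fl F OpMul (alpha H 1) (alpha H 2)).
    by apply: fl_num => //; apply: fpnum_entry.
  have [||//|d1 hd1 q1] := fl_mul_model _ _ _ e1; [exact: fpnum_entry | exact: fpnum_entry |].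
  have [||//|d2 hd2 q2] := fl_mul_model _ _ _ e2; [exact: fpnum_entry | exact: fpnum_entry |].
  have [||//|eps heps q3] := fl_div_model _ _ _ e3; [by [] | exact: (num_hb 2) |].
  rewrite -chat22 /= in q3; have {}q3 := sub_round_error u1 heps q3.
  rewrite q1 q2 /= in q3.
  have -> : cerr H chat 2 2 = d1 * (alpha H 2 * alpha H 1)
      - d2 * (entry H 1 2 * beta H 2) - eps * chat 2%N 2%N.
    by rewrite /cerr ccoef22 {1}q3; ring.
  exact: ler_norm_mul_bound3.
have [e1 e2 e3 e4] := exc_chat2 i lein.
have ? : (1 <= i.-1 <= n)%N by lia.
have ? : (2 <= i.-1 <= n)%N by lia.
have ? : (2 <= i <= n)%N by lia.
have ? : (0 < i <= n)%N by lia.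
have num_sub : fpnum F (fl F OpSub (chat 2%N i.-1) (fl F OpMul (alpha H i) (chat 1%N i.-1))).
  by apply: fl_num => //; [apply: num_c2 | apply: num_ac].
have [||//|d1 hd1 q1] := fl_mul_model _ _ _ e1; [exact: fpnum_entry | exact: num_c1 |].
have [||//|d2 hd2 q2] := fl_mul_model _ _ _ e2; [exact: num_c2 | exact: num_ac |].
have [||//|d3 hd3 q3] := fl_mul_model _ _ _ e3; [exact: fpnum_entry | exact: fpnum_entry |].
have [||//|eps heps q4] := fl_div_model _ _ _ e4; [by [] | exact: num_hb |].
rewrite -chat2_rec //= in q4; have {}q4 := sub_round_error u1 heps q4.
rewrite q2 q1 q3 /= in q4.
(* The product with [chat 1 i.-1] is rounded by [d1] and again, inside the subtraction, by [d2]; the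
   excess of the combined factor over 1 is split off for [gamma F 2]. *)
have -> : cerr H chat 2 i =
    cerr H chat 2 i.-1 - alpha H i * cerr H chat 1 i.-1
    + (d2 * chat 2%N i.-1 - d3 * (entry H i.-1 i * beta H i) - eps * chat 2%N i)
    - ((1 + d2) * (1 + d1) - 1) * (alpha H i * chat 1%N i.-1).
  by rewrite /cerr ccoef2_rec // {1}q4; ring.
apply: le_trans (ler_normB _ _) _; apply: lerD; last first.
  exact/ler_norm_mul_bound/two_rounding_gamma.
apply: le_trans (ler_normD _ _) _; apply: lerD; [exact: ler_normB|].
exact: ler_norm_mul_bound3.
Qed.
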